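(* Let $X$ be a connected reduced curve. The translation action of $\mathbb Z^{I(X)}$ on $\mathrm{VStab}(X)$ is such that: (i) the degeneracy map $\mathcal D$ is invariant under the action of $\mathbb Z^{I(X)}$ on its domain, i.e. $\mathcal D(\mathfrak s+\tau)=\mathcal D(\mathfrak s)$; (ii) the action preserves the poset structure, i.e. if $\mathfrak s\ge\mathfrak t$ then $\mathfrak s+\tau\ge\mathfrak t+\tau$ for any $\tau\in\mathbb Z^{I(X)}$; (iii) there are finitely many orbits.
   Context: $X$ is a connected reduced projective curve over an algebraically closed field, $I(X)$ is its set of irreducible components, and $X_v$ is the component corresponding to $v\in I(X)$. A subcurve $Y\subseteq X$ is a union of some (possibly none, possibly all) irreducible components; $Y^{\mathsf c}:=\overline{X\setminus Y}$. $\mathrm{BCon}(X)$ is the set of subcurves $Y\ne\emptyset,X$ with $Y$ and $Y^{\mathsf c}$ both connected. A V-stability condition of characteristic $\chi\in\mathbb Z$ on $X$ is a function $\mathfrak s:\mathrm{BCon}(X)\to\mathbb Z$ such that: (1) for all $Y\in\mathrm{BCon}(X)$, $\mathfrak s_Y+\mathfrak s_{Y^{\mathsf c}}-\chi\in\{0,1\}$; $Y$ is $\mathfrak s$-degenerate if this number is $0$ and $\mathfrak s$-nondegenerate otherwise; (2) for all $Y_1,Y_2,Y_3\in\mathrm{BCon}(X)$ pairwise without common irreducible components and with $X=Y_1\cup Y_2\cup Y_3$: (a) if two of the $Y_i$ are $\mathfrak s$-degenerate, so is the third; (b) $\sum_{i=1}^3\mathfrak s_{Y_i}-\chi$ lies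 in $\{1,2\}$ if all $Y_i$ are $\mathfrak s$-nondegenerate, in $\{1\}$ if exactly one is $\mathfrak s$-degenerate, and in $\{0\}$ if all are $\mathfrak s$-degenerate. The characteristic of $\mathfrak s$ is denoted $|\mathfrak s|$, and the degeneracy map sends $\mathfrak s$ to $\mathcal D(\mathfrak s):=\{Y\in\mathrm{BCon}(X): Y\text{ is }\mathfrak s\text{-degenerate}\}$. $\mathrm{VStab}(X)$ is the set of all V-stability conditions on $X$ (of all characteristics), ordered by: $\mathfrak s\ge\mathfrak t$ iff $|\mathfrak s|=|\mathfrak t|$ and $\mathfrak s_Y\ge\mathfrak t_Y$ for all $Y\in\mathrm{BCon}(X)$. The translation of $\mathfrak s\in\mathrm{VStab}(X)$ by $\tau:I(X)\to\mathbb Z$ is the V-stability condition $\mathfrak s+\tau$ given by $Y\mapsto\mathfrak s_Y+\sum_{X_v\subseteq Y}\tau_v$, of characteristic $|\mathfrak s|+\sum_{v\in I(X)}\tau_v$; this defines an action of $\mathbb Z^{I(X)}$ on $\mathrm{VStab}(X)$. *)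

(* Defs.v *)
From HB Require Import structures.
From mathcomp Require Import all_boot all_order all_algebra.
From mathcomp Require Import boolp classical_sets functions cardinality fsbigop.
From mathcomp Require Import topology_structure connected.
From mathcomp Require Import mpoly.

Set Implicit Arguments.
Unset Strict Implicit.
Unset Printing Implicit Defensive.

Import Order.TTheory GRing.Theory Num.Theory.

Local Open Scope classical_set_scope.
Local Open Scope ring_scope.

Section Irreducible.
Variable T : topologicalType.
Implicit Types A B C Z W : set T.

Definition irreducible Z :=
  Z !=set0 /\
  forall A B, closed A -> closed B -> Z `<=` A `|` B -> Z `<=` A \/ Z `<=` B.

Definition irreducible_components A : set (set T) :=
  [set Z | [/\ irreducible Z, Z `<=` A &
     forall W, irreducible W -> W `<=` A -> Z `<=` W -> W = Z]].

(* Strict chains C 0 < ... < C m; for closed A the sets closed in A are the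
   closed sets contained in A. *)
Definition irreducible_chain A (m : nat) :=
  exists C : nat -> set T,
    (forall i, (i <= m)%N -> [/\ closed (C i), irreducible (C i) & C i `<=` A])
    /\ (forall i, (i < m)%N -> C i `<` C i.+1).

Definition has_krull_dim A (d : nat) :=
  irreducible_chain A d /\ ~ irreducible_chain A d.+1.

Definition noetherian :=
  ~ exists Z : nat -> set T,
      (forall i, closed (Z i)) /\ (forall i, Z i.+1 `<` Z i).

Lemma irreducible_bigcup Z (s : seq (set T)) :
  irreducible Z -> (forall W, W \in s -> closed W) ->
  Z `<=` \bigcup_(W in [set` s]) W -> exists2 W, W \in s & Z `<=` W.
Proof.
move=> [Z0 Zi]; elim: s => [|W s IH] cs Zs.
  by case: Z0 => x /Zs [].
have cW : closed W by apply: cs; rewrite mem_head.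
have cs' V : V \in s -> closed V by move=> Vs; apply: cs; rewrite inE Vs orbT.
have cB : closed (\bigcup_(V in [set` s]) V).
  by apply: closed_bigcup => //; apply: finite_seq.
have [|ZW|ZV] := Zi _ _ cW cB.
- move=> x /Zs [V /=]; rewrite inE => /predU1P[->|Vs] Vx; first by left.
  by right; exists V.
- by exists W; rewrite ?mem_head.
- by have [V Vs ZV'] := IH cs' ZV; exists V; rewrite ?inE ?Vs ?orbT.
Qed.

Lemma irreducible_closure Z : irreducible Z -> irreducible (closure Z).
Proof.
move=> [[x Zx] Zi]; split; first by exists x; apply: subset_closure.
move=> A B cA cB ZAB.
have [|ZA|ZB] := Zi A B cA cB; first exact: subset_trans (@subset_closure _ _) ZAB.
- by left; move/closure_id: cA => ->; apply: closureS.
- by right; move/closure_id: cB => ->; apply: closureS.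
Qed.

Lemma irreducible_component_closed A Z :
  closed A -> irreducible_components A Z -> closed Z.
Proof.
move=> cA [Zi ZA Zmax]; rewrite -(Zmax (closure Z)).
- exact: closed_closure.
- exact: irreducible_closure.
- by move/closure_id: cA => ->; apply: closureS.
- exact: subset_closure.
Qed.

Hypothesis noethT : noetherian.

Lemma noetherian_decomposition A : closed A ->
  exists s : seq (set T), (forall W, W \in s -> closed W /\ irreducible W)
    /\ A = \bigcup_(W in [set` s]) W.
Proof.
move=> cA; apply: contrapT => badA.
pose dec C := exists s : seq (set T),
  (forall W, W \in s -> closed W /\ irreducible W)
    /\ C = \bigcup_(W in [set` s]) W.
pose bad := {C : set T | closed C /\ ~ dec C}.
have next (C : bad) : exists D : bad, sval D `<` sval C.
  case: C => C [cC badC] /=; apply: contrapT => nD.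
  have good D : closed D -> D `<` C -> dec D.
    move=> cD DC; apply: contrapT => badD; apply: nD.
    by exists (exist _ D (conj cD badD)).
  apply: badC; have [C0|C0] := eqVneq C set0.
    by exists [::]; split => //; rewrite C0 set_nil bigcup_set0.
  have [Ci|nCi] := pselect (irreducible C).
    exists [:: C]; split => [W|]; first by rewrite inE => /eqP ->.
    by rewrite set_cons1 bigcup_set1.
  have [B1 [B2 [cB1 cB2 CB nB1 nB2]]] : exists B1 B2,
      [/\ closed B1, closed B2, C `<=` B1 `|` B2, ~ C `<=` B1 & ~ C `<=` B2].
    apply: contrapT => nB; apply: nCi; split; first exact/set0P.
    move=> B1 B2 cB1 cB2 CB; apply: contrapT => /not_orP[n1 n2].
    by apply: nB; exists B1, B2.
  have sub B : closed B -> ~ C `<=` B -> dec (C `&` B).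
    move=> cB nB; apply: good; first exact: closedI.
    split; first exact: subIsetl.
    by move=> /= CCB; apply: nB => x /CCB[].
  have [s1 [s1P e1]] := sub _ cB1 nB1; have [s2 [s2P e2]] := sub _ cB2 nB2.
  exists (s1 ++ s2); split => [W|].
    by rewrite mem_cat => /orP[/s1P|/s2P].
  have -> : C = (C `&` B1) `|` (C `&` B2).
    by rewrite -setIUr; apply/esym/setIidPl.
  rewrite e1 e2 -bigcup_setU; congr bigcup.
  apply/seteqP; split => W /=; rewrite mem_cat; first by case=> ->; rewrite ?orbT.
  by move=> /orP[]; [left|right].
have [f fP] := choice next.
pose g n := iter n f (exist _ A (conj cA badA) : bad).
apply: noethT; exists (fun n => sval (g n)); split => i; last exact: fP.
by case: (g i) => ? [].
Qed.

Lemma noetherian_components A : closed A ->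
  finite_set (irreducible_components A)
  /\ A = \bigcup_(Z in irreducible_components A) Z.
Proof.
move=> cA; have [s [sP As]] := noetherian_decomposition cA.
have cs W : W \in s -> closed W by case/sP.
have sA W : W \in s -> W `<=` A by move=> Ws; rewrite As; apply: bigcup_sup.
have subs : irreducible_components A `<=` [set` s].
  move=> Z [Zi ZA Zmax].
  have [|W Ws ZW] := irreducible_bigcup Zi cs; first by rewrite -As.
  by rewrite -(Zmax W) //=; [case: (sP _ Ws)|apply: sA].
split; first exact: sub_finite_set subs (finite_seq s).
apply/seteqP; split => [x|x [Z [_ ZA _]]]; last exact: ZA.
rewrite {1}As => -[W /= Ws Wx].
pose m Z := count (fun V => `[< Z `<=` V >]) s.
have ex : exists n, `[< exists Z, [/\ Z \in s, W `<=` Z & m Z = n] >].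
  by exists (m W); apply/asboolP; exists W; split => //; apply: subset_refl.
case: (ex_minnP ex) => n /asboolP[Z [Zs WZ mZ]] nmin.
exists Z; last exact: WZ.
have [cZ Zi] := sP _ Zs.
split => // [|V Vi VA ZV]; first exact: sA.
have [|U Us VU] := irreducible_bigcup Vi cs; first by rewrite -As.
apply/seteqP; split => // y Vy; apply: contrapT => nZy.
have : (n <= m U)%N.
  apply: nmin; apply/asboolP; exists U; split => //.
  exact: subset_trans WZ (subset_trans ZV VU).
rewrite -mZ leqNgt => /negP; apply; rewrite /m.
pose a V := `[< Z `<=` V >]; pose b V := `[< U `<=` V >].
have -> : count b s = count (predI b a) s.
  apply: eq_count => V' /=; rewrite /a /b; apply/asboolP/andP => [UV'|[/asboolP//]].
  split; apply/asboolP => //.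
  exact: subset_trans ZV (subset_trans VU UV').
rewrite -count_filter -[count a s]size_filter -(count_predC b) -addn1 leq_add2l.
rewrite count_filter -has_count; apply/hasP; exists Z => //=.
apply/andP; split; last exact/asboolP.
by apply/negP => /asboolP UZ; apply: nZy; apply: UZ; apply: VU.
Qed.

End Irreducible.

Section FiniteBasis.
Variable T : eqType.

Definition finite_basis (le : T -> T -> bool) := forall L : set T,
  exists s : seq T, (forall x, x \in s -> L x) /\
    forall x, L x -> exists2 y, y \in s & le y x.

Lemma finite_basis_nat (le : T -> T -> bool) (f : T -> nat) :
  finite_basis le -> finite_basis (fun x y => le x y && (f x <= f y)%N).
Proof.
move=> fb L; have [s0 [s0L s0P]] := fb L.
have [g gP] := choice (fun j => fb (L `&` [set x | f x = j])).
pose K := (\max_(x <- s0) f x)%N.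
exists (s0 ++ flatten [seq g j | j <- iota 0 K]); split.
  move=> x; rewrite mem_cat => /orP[/s0L //|/flatten_mapP[j _ xj]].
  by have [/(_ _ xj) []] := gP j.
move=> x Lx; have [fx|fx] := ltnP (f x) K.
  have [_ /(_ x)] := gP (f x); case=> // y ys yx; exists y.
    rewrite mem_cat; apply/orP; right; apply/flatten_mapP; exists (f x) => //.
    by rewrite mem_iota.
  have [/(_ _ ys) [_ /= fy]] := gP (f x) => _.
  by rewrite yx fy /=.
have [y ys yx] := s0P _ Lx; exists y; first by rewrite mem_cat ys.
by rewrite yx (leq_trans _ fx) // /K (leq_bigmax_seq _ ys).
Qed.

End FiniteBasis.

Lemma dickson n : finite_basis (fun m1 m2 : 'X_{1..n} => (m1 <= m2)%MM).
Proof.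
have H k : finite_basis (fun m1 m2 : 'X_{1..n} =>
    [forall i : 'I_n, (i < k)%N ==> (m1 i <= m2 i)%N]).
  elim: k => [|k IH] L.
    have [[x Lx]|L0] := pselect (L !=set0).
      exists [:: x]; split => [y|y _]; first by rewrite inE => /eqP->.
      by exists x; rewrite ?inE //; apply/forallP.
    by exists [::]; split => // x Lx; case: L0; exists x.
  have [kn|nk] := ltnP k n; last first.
    have [s [sL sP]] := IH L; exists s; split => // x /sP[y ys yx]; exists y => //.
    apply/forallP => i; apply/implyP => _.
    by have /forallP/(_ i) := yx; rewrite (leq_trans (ltn_ord i) nk).
  have [s [sL sP]] := finite_basis_nat (fun m : 'X_{1..n} => m (Ordinal kn)) IH L.
  exists s; split => // x /sP[y ys /andP[/forallP yx yk]]; exists y => //.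
  apply/forallP => i; apply/implyP; rewrite ltnS leq_eqVlt => /predU1P[ik|ik].
    by have -> : i = Ordinal kn by apply: val_inj.
  by have := yx i; rewrite ik.
move=> L; have [s [sL sP]] := H n L; exists s; split => // x /sP[y ys yx].
exists y => //; apply/mnm_lepP => i; have /forallP/(_ i) := yx.
by rewrite ltn_ord.
Qed.

Lemma hilbert_basis (K : fieldType) n (J : set {mpoly K[n]}) :
  (forall p q r, J p -> J q -> J (p - r * q)) ->
  exists F : seq {mpoly K[n]}, (forall f, f \in F -> J f) /\
    forall p v, J p -> (forall f, f \in F -> f.@[v] = 0) -> p.@[v] = 0.
Proof.
move=> idJ.
have [s [sL sP]] := dickson [set m | exists p, [/\ J p, p != 0 & mlead p = m]].
have [F [FJ FP]] : exists F : seq {mpoly K[n]},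
    (forall f, f \in F -> J f /\ f != 0) /\
    forall m, m \in s -> exists2 f, f \in F & mlead f = m.
  elim: s sL {sP} => [|m s IH] sL; first by exists [::].
  have [|F [FJ FP]] := IH; first by move=> x xs; apply: sL; rewrite inE xs orbT.
  have [p [Jp p0 pm]] := sL m (mem_head _ _).
  exists (p :: F); split => [f|m']; first by rewrite inE => /predU1P[->|/FJ].
  rewrite inE => /predU1P[->|/FP[f fF fm]]; first by exists p; rewrite ?mem_head.
  by exists f; rewrite ?inE ?fF ?orbT.
exists F; split => [f /FJ[]//|p v Jp Fv].
elim/mleadrect: p Jp => p IH Jp.
have [->|p0] := eqVneq p 0; first by rewrite meval0.
have [|m ms mp] := sP (mlead p); first by exists p.
have [f fF fm] := FP m ms; have [Jf f0] := FJ f fF.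
pose c := mleadc p / mleadc f; pose r := c *: 'X_[(mlead p - m)%MM].
have lf : mleadc f != 0 by rewrite mleadc_eq0.
have lp : mleadc p != 0 by rewrite mleadc_eq0.
have c0 : c != 0 by rewrite mulf_neq0 ?invr_eq0.
pose q := p - r * f.
have Jq : J q by apply: idJ.
have -> : p = q + r * f by rewrite subrK.
rewrite mevalD mevalM (Fv f fF) mulr0 addr0.
have [->|q0] := eqVneq q 0; first by rewrite meval0.
apply: IH => //.
have X0 : 'X_[(mlead p - m)%MM] != 0 :> {mpoly K[n]}.
  by rewrite -mleadc_eq0 mleadXm mcoeffX eqxx oner_neq0.
have r0 : r != 0 by rewrite scaler_eq0 negb_or c0.
have lr : mlead (r * f) = mlead p.
  by rewrite mleadM // mleadZ // mleadXm fm submK.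
have cr : (r * f)@_(mlead p) = mleadc p.
  rewrite -[in LHS]lr mleadM // mleadcM mleadcZE mleadXm mcoeffX eqxx mulr1.
  by rewrite /c mulfVK.
have qs : (mlead q <= mlead p)%O.
  by rewrite (le_trans (mleadB_le _ _)) // lr leUx lexx.
rewrite lt_neqAle qs andbT; apply/eqP => e.
by move: q0; rewrite -mleadc_eq0 e /q mcoeffB cr subrr eqxx.
Qed.

(* A point of P^n is a line through the origin of K^(n+1). *)
Definition projective_space (K : fieldType) (n : nat) : Type :=
  {U : {vspace 'rV[K]_n.+1} | \dim U == 1%N}.

Definition line_of (K : fieldType) n (x : projective_space K n) :
  {vspace 'rV[K]_n.+1} := sval x.

HB.instance Definition _ (K : fieldType) n :=
  Choice.on (projective_space K n).

Section Zariski.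
Variables (K : fieldType) (n : nat).
Local Notation P := (projective_space K n).

Definition zero_locus (S : set {mpoly K[n.+1]}) : set P :=
  [set x | forall p, S p -> forall v : 'rV[K]_n.+1, v \in line_of x -> p.@[v 0] = 0].

Definition zariski_closed (A : set P) :=
  exists2 S : set {mpoly K[n.+1]},
    (forall p, S p -> exists d, p \is d.-homog) & A = zero_locus S.

Lemma projective_point (x : P) :
  exists2 v : 'rV[K]_n.+1, v \in line_of x &
    forall w : 'rV[K]_n.+1, w \in line_of x -> exists c, w = c *: v.
Proof.
case: x => U dU; rewrite /line_of /=; move/eqP: dU => dU.
exists (vpick U); first exact: memv_pick.
suff UE : U = <[vpick U]>%VS by move=> w; rewrite {1}UE => /vlineP.
apply/eqP; rewrite eq_sym eqEdim -memvE memv_pick dU dim_vline.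
by rewrite vpick0 -dimv_eq0 dU.
Qed.

Lemma meval_homog d (p : {mpoly K[n.+1]}) (v : 'rV[K]_n.+1) c :
  p \is d.-homog -> p.@[(c *: v) 0] = c ^+ d * p.@[v 0].
Proof.
move=> /dhomogP hp; rewrite !mevalE mulr_sumr !big_seq.
apply: eq_bigr => m /hp /= <-; rewrite mdegE.
rewrite mulrCA; congr (_ * _); rewrite expr_sum -big_split /=.
by apply: eq_bigr => i _; rewrite mxE exprMn.
Qed.

Lemma zariski_closedT : zariski_closed setT.
Proof. by exists set0 => //; apply/seteqP; split => // x _ p []. Qed.

Lemma zariski_closed0 : zariski_closed set0.
Proof.
exists [set 1]; first by move=> _ ->; exists 0%N; apply: dhomog1.
apply/seteqP; split => // x /(_ 1 erefl 0); rewrite mem0v meval1 => /(_ isT)/eqP.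
by rewrite oner_eq0.
Qed.

Lemma zariski_closedU A B :
  zariski_closed A -> zariski_closed B -> zariski_closed (A `|` B).
Proof.
move=> [S1 h1 ->] [S2 h2 ->].
exists [set pq | exists p q, [/\ S1 p, S2 q & pq = p * q]].
  move=> _ [p [q [/h1[d pd] /h2[e qe] ->]]]; exists (d + e)%N; exact: dhomogM.
apply/seteqP; split => [x H _ [p [q [S1p S2q ->]]] v vx|x H].
  rewrite mevalM; case: H => H.
    by rewrite (H _ S1p _ vx) mul0r.
  by rewrite (H _ S2q _ vx) mulr0.
apply: contrapT => /not_orP[/existsNP[p /not_implyP[S1p]]].
move=> /existsNP[v /not_implyP[vx pv]] /existsNP[q /not_implyP[S2q]].
move=> /existsNP[w /not_implyP[wx qw]].
have [u ux uP] := projective_point x.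
have [d pd] := h1 _ S1p; have [e qe] := h2 _ S2q.
have [a va] := uP _ vx; have [b wb] := uP _ wx.
have := H _ (ex_intro _ p (ex_intro _ q (And3 S1p S2q erefl))) _ ux.
rewrite mevalM => /eqP; rewrite mulf_eq0 => /orP[/eqP pu|/eqP qu].
  by apply: pv; rewrite va (meval_homog _ _ pd) pu mulr0.
by apply: qw; rewrite wb (meval_homog _ _ qe) qu mulr0.
Qed.

Lemma zariski_closed_bigcap I (f : I -> set P) :
  (forall i, zariski_closed (f i)) -> zariski_closed (\bigcap_i f i).
Proof.
move=> cf; have {}cf i : exists S : set {mpoly K[n.+1]},
    (forall p, S p -> exists d, p \is d.-homog) /\ f i = zero_locus S.
  by have [S hS fS] := cf i; exists S.
have [g gP] := choice cf.
exists (\bigcup_i g i).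
  by move=> p [i _]; have [h _] := gP i; apply: h.
apply/seteqP; split => [x H p [i _ ip] v vx|x H i _].
  have := H i Logic.I; have [_ ->] := gP i; exact.
by have [_ ->] := gP i => p ip; apply: H; exists i.
Qed.

Let zopen := [set A : set P | zariski_closed (~` A)].

Let zopenT : zopen setT.
Proof. by rewrite /zopen /= setCT; apply: zariski_closed0. Qed.

Let zopenI : setI_closed zopen.
Proof. by move=> A B; rewrite /zopen /= setCI; apply: zariski_closedU. Qed.

Let zopen_bigU (I : Type) (f : I -> set P) :
  (forall i, zopen (f i)) -> zopen (\bigcup_i f i).
Proof. by rewrite /zopen /= setC_bigcup; apply: zariski_closed_bigcap. Qed.

HB.instance Definition _ :=
  isOpenTopological.Build P zopenT zopenI zopen_bigU.

Lemma zariski_closedE (A : set P) : closed A = zariski_closed A.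
Proof. by rewrite -openC -[in RHS](setCK A). Qed.

Lemma projective_space_noetherian : noetherian P.
Proof.
move=> [Z [cZ ZZ]].
pose J := [set p : {mpoly K[n.+1]} |
  exists i, forall x, Z i x -> forall v : 'rV[K]_n.+1, v \in line_of x -> p.@[v 0] = 0].
have mono i j : (i <= j)%N -> Z j `<=` Z i.
  move=> /subnK <-; elim: (j - i)%N => [//|k IH].
  by apply: subset_trans IH; have [] := ZZ (k + i)%N.
have idJ p q r : J p -> J q -> J (p - r * q).
  move=> [i Hi] [j Hj]; exists (maxn i j) => x Zx v vx.
  rewrite mevalB mevalM (Hi x) ?(Hj x) ?mulr0 ?subr0 //.
    exact: mono (leq_maxr i j) _ Zx.
  exact: mono (leq_maxl i j) _ Zx.
have [F [FJ FP]] := hilbert_basis idJ.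
have [N HN] : exists N, forall f, f \in F ->
    forall x, Z N x -> forall v : 'rV[K]_n.+1, v \in line_of x -> f.@[v 0] = 0.
  elim: F FJ {FP} => [|f F IH] FJ; first by exists 0%N.
  have [|N HN] := IH; first by move=> g gF; apply: FJ; rewrite inE gF orbT.
  have [i Hi] := FJ f (mem_head _ _); exists (maxn i N) => g.
  rewrite inE => /predU1P[->|gF] x Zx.
    exact/Hi/(mono _ _ (leq_maxl i N)).
  exact/(HN g gF)/(mono _ _ (leq_maxr i N)).
have [_] := ZZ N; apply.
have := cZ N.+1; rewrite zariski_closedE => -[S hS ZS].
rewrite ZS => x Zx p Sp v vx; apply: FP => [|f fF]; last exact: HN Zx _ vx.
by exists N.+1 => y; rewrite ZS => Hy; apply: Hy.
Qed.

End Zariski.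

(* A reduced projective scheme over an algebraically closed field is determined
   by its closed points, a Zariski closed subset of some P^n; topological
   notions (components, connectedness, dimension) can be read there. *)
Record curve (k : closedFieldType) := Curve {
  ambient_dim : nat;
  curve_points :> set (projective_space k ambient_dim);
  curve_closed : closed curve_points;
  curve_neq0 : curve_points !=set0;
  curve_pure_dim1 : forall Z,
    irreducible_components curve_points Z -> has_krull_dim Z 1%N
}.

Section Subcurves.
Variables (k : closedFieldType) (X : curve k).
Local Notation T := (projective_space k (ambient_dim X)).
Local Notation I := (irreducible_components X).
Implicit Types Y Z W : set T.

Definition subcurve Y :=
  exists2 A : set (set T), A `<=` I & Y = \bigcup_(Z in A) Z.

Definition compl Y : set T := closure (X `\` Y).

Definition bcon : set (set T) :=
  [set Y | [/\ subcurve Y, Y <> set0, Y <> X, connected Y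
             & connected (compl Y)]].

Definition no_common_component Y1 Y2 :=
  forall Z, I Z -> ~ (Z `<=` Y1 /\ Z `<=` Y2).

Lemma finite_components : finite_set I.
Proof.
exact: (noetherian_components (@projective_space_noetherian _ _)
          (@curve_closed _ X)).1.
Qed.

Lemma components_cover : \bigcup_(Z in I) Z = X.
Proof.
apply/esym; exact: (noetherian_components (@projective_space_noetherian _ _)
               (@curve_closed _ X)).2.
Qed.

Lemma component_closed Z : I Z -> closed Z.
Proof. exact: irreducible_component_closed (@curve_closed _ X). Qed.

Lemma component_irreducible Z : I Z -> irreducible Z.
Proof. by case. Qed.

Lemma components_closed (A : set (set T)) :
  A `<=` I -> closed (\bigcup_(Z in A) Z).
Proof.
move=> AI; apply: closed_bigcup; first exact: sub_finite_set AI finite_components.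
by move=> Z /AI; apply: component_closed.
Qed.

Lemma component_sub_bigcup (A : set (set T)) Z :
  A `<=` I -> I Z -> Z `<=` \bigcup_(W in A) W -> A Z.
Proof.
move=> AI IZ ZA.
have /finite_seqP[s sA] := sub_finite_set AI finite_components.
rewrite sA in AI ZA *.
have [W Ws ZW] := irreducible_bigcup (component_irreducible IZ)
  (fun W Ws => component_closed (AI W Ws)) ZA.
have [_ _ Zmax] := IZ; have [Wi WX _] := AI _ Ws.
by rewrite -(Zmax W).
Qed.

Lemma subcurve_closed Y : subcurve Y -> closed Y.
Proof. by move=> [A AI ->]; apply: components_closed. Qed.

Lemma subcurve_sub Y : subcurve Y -> Y `<=` X.
Proof. by move=> [A AI ->] x [Z /AI[_ ZX _]]; apply: ZX. Qed.

Lemma subcurveE Y : subcurve Y -> Y = \bigcup_(Z in I `&` [set Z | Z `<=` Y]) Z.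
Proof.
move=> [A AI YA]; apply/seteqP; split => [x|x [Z [_ ZY]]]; last exact: ZY.
rewrite {1}YA => -[Z AZ Zx]; exists Z => //; split; first exact: AI.
by rewrite YA; apply: bigcup_sup.
Qed.

Lemma complE Y : subcurve Y ->
  compl Y = \bigcup_(Z in I `&` [set Z | ~ Z `<=` Y]) Z.
Proof.
move=> sY; apply/seteqP; split.
  have sub : I `&` [set Z | ~ Z `<=` Y] `<=` I by move=> Z [].
  have /closure_id -> := components_closed sub.
  apply: closureS => x [Xx nYx].
  have : (\bigcup_(Z in I) Z) x by rewrite components_cover.
  by move=> [Z IZ Zx]; exists Z => //; split => // ZY; apply/nYx/ZY.
apply: bigcup_sub => Z [IZ nZY]; have [_ Zi] := component_irreducible IZ.
have [|//|//] := Zi Y (compl Y) (subcurve_closed sY) (@closed_closure _ _).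
move=> x Zx; have [Yx|nYx] := pselect (Y x); first by left.
by right; apply: subset_closure; split => //; case: IZ => _ ZX _; apply: ZX.
Qed.

Lemma component_compl Y Z :
  subcurve Y -> I Z -> (Z `<=` compl Y) <-> ~ Z `<=` Y.
Proof.
move=> sY IZ; rewrite complE //; split => [ZA|nZY]; last exact: bigcup_sup.
have sub : I `&` [set Z | ~ Z `<=` Y] `<=` I by move=> W [].
by case: (component_sub_bigcup sub IZ ZA).
Qed.

Lemma subcurve_compl Y : subcurve Y -> subcurve (compl Y).
Proof. by move=> sY; eexists; last exact: complE; move=> Z []. Qed.

Lemma complK Y : subcurve Y -> compl (compl Y) = Y.
Proof.
move=> sY; rewrite complE; last exact: subcurve_compl.
rewrite [RHS]subcurveE //; congr bigcup; apply/seteqP; split => Z [IZ /= h];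
  split => //=.
  by apply: contrapT => nZY; apply: h; apply/component_compl.
by rewrite component_compl.
Qed.

Lemma subcurve_cover Y : subcurve Y -> X = Y `|` compl Y :> set T.
Proof.
move=> sY; apply/seteqP; split => x.
  move=> Xx; have [Yx|nYx] := pselect (Y x); first by left.
  by right; apply: subset_closure.
by case; [exact: subcurve_sub|exact/subcurve_sub/subcurve_compl].
Qed.

Lemma bcon_compl Y : bcon Y -> bcon (compl Y).
Proof.
move=> [sY Y0 YX cY cYc]; split => //.
- exact: subcurve_compl.
- move=> /closure_eq0 XY; apply: YX; apply/seteqP; split.
    exact: subcurve_sub.
  by rewrite -setD_eq0.
- move=> cX; apply: Y0; rewrite -(complK sY) cX /compl setDv.
  exact/esym/closure_id/closed0.
- by rewrite complK.
Qed.

End Subcurves.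

Arguments subcurve {k} X Y.
Arguments compl {k} X Y.
Arguments bcon {k} X _.
Arguments no_common_component {k} X Y1 Y2.

Section VStability.
Variables (k : closedFieldType) (X : curve k).
Local Notation T := (projective_space k (ambient_dim X)).
Local Notation I := (irreducible_components X).
Implicit Types (Y : bcon X) (tau : I -> int) (chi : int).

Definition bcompl Y : bcon X := 
  exist _ (compl X (val Y)) (mem_set (bcon_compl (@set_valP _ (bcon X) Y))).

Definition degenerate chi (s : bcon X -> int) Y : bool :=
  s Y + s (bcompl Y) - chi == 0.

(* d1 + d2 + d3 is the number of degenerate subcurves among Y1, Y2, Y3. *)
Definition is_vstab chi (s : bcon X -> int) : Prop :=
  (forall Y, s Y + s (bcompl Y) - chi \in [:: 0; 1]) /\
  forall Y1 Y2 Y3,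
    no_common_component X (val Y1) (val Y2) ->
    no_common_component X (val Y1) (val Y3) ->
    no_common_component X (val Y2) (val Y3) ->
    X = val Y1 `|` val Y2 `|` val Y3 :> set _ ->
    let d1 := degenerate chi s Y1 in
    let d2 := degenerate chi s Y2 in
    let d3 := degenerate chi s Y3 in
    [/\ d1 -> d2 -> d3, d1 -> d3 -> d2 & d2 -> d3 -> d1] /\
    [/\ (d1 + d2 + d3 = 0)%N -> s Y1 + s Y2 + s Y3 - chi \in [:: 1; 2],
        (d1 + d2 + d3 = 1)%N -> s Y1 + s Y2 + s Y3 - chi = 1
      & (d1 + d2 + d3 = 3)%N -> s Y1 + s Y2 + s Y3 - chi = 0].

(* The characteristic is part of the data: it is not determined by the function
   when X is irreducible, as bcon X is then empty. *)
Record vstab := VStab {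
  vstab_fun :> bcon X -> int;
  characteristic : int;
  vstabP : is_vstab characteristic vstab_fun
}.

Definition degeneracy (s : vstab) : set (bcon X) :=
  [set Y | degenerate (characteristic s) s Y].

Definition vstab_ge (s t : vstab) : Prop :=
  characteristic s = characteristic t /\ forall Y, s Y >= t Y.

(* The sum over the components contained in Y; there are finitely many of them
   by finite_components, so this is a genuine finite sum. *)
Definition weight tau (Y : set T) : int :=
  \sum_(Z \in [set Z : I | val Z `<=` Y]) tau Z.

Definition total_weight tau : int := \sum_(Z \in [set: I]) tau Z.

Lemma finite_componentsT (A : set I) : finite_set A.
Proof.
apply: (@sub_finite_set _ _ [set: I]) => //.
have -> : [set: I] = val @^-1` (I : set _).
  by apply/seteqP; split => // Z _; apply: set_valP.
apply: finite_preimage; last exact: finite_components.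
by move=> Z1 Z2 _ _; apply: val_inj.
Qed.

Lemma weight_split tau (Y1 Y2 : set T) :
  subcurve X Y1 -> subcurve X Y2 -> no_common_component X Y1 Y2 ->
  weight tau (Y1 `|` Y2) = weight tau Y1 + weight tau Y2.
Proof.
move=> s1 s2 d12; rewrite /weight -fsbigU0; try exact: finite_componentsT.
  apply: eq_fsbigl; apply/seteqP; split => Z /=.
    have [_ Zi] := component_irreducible (set_valP Z).
    exact: Zi (subcurve_closed s1) (subcurve_closed s2).
  by case => h x Zx; [left|right]; apply: h.
by move=> Z /= [Z1 Z2]; apply: (d12 _ (set_valP Z)).
Qed.

Lemma weightT tau : weight tau X = total_weight tau.
Proof.
apply: eq_fsbigl; apply/seteqP; split => // Z _ /=.
by case: (set_valP Z).
Qed.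

Lemma bcon_subcurve Y : subcurve X (val Y).
Proof. by case: (set_valP Y). Qed.

Lemma subcurveU (Y1 Y2 : set T) : subcurve X Y1 -> subcurve X Y2 -> subcurve X (Y1 `|` Y2).
Proof.
move=> [A AI ->] [B BI ->]; exists (A `|` B); last by rewrite bigcup_setU.
by move=> Z [/AI|/BI].
Qed.

Lemma weight_bcompl tau Y :
  weight tau (val Y) + weight tau (val (bcompl Y)) = total_weight tau.
Proof.
have sY := bcon_subcurve Y; rewrite -[val (bcompl Y)]/(compl X (val Y)).
rewrite -weight_split //; last first.
- by move=> Z IZ [ZY] /(component_compl sY IZ).
- exact: subcurve_compl.
by rewrite -(subcurve_cover sY) weightT.
Qed.

Lemma weight3 tau Y1 Y2 Y3 :
  no_common_component X (val Y1) (val Y2) ->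
  no_common_component X (val Y1) (val Y3) ->
  no_common_component X (val Y2) (val Y3) ->
  X = val Y1 `|` val Y2 `|` val Y3 :> set _ ->
  weight tau (val Y1) + weight tau (val Y2) + weight tau (val Y3)
    = total_weight tau.
Proof.
move=> d12 d13 d23 XY; rewrite -weightT XY !weight_split //;
  try exact: bcon_subcurve.
  by apply: subcurveU; apply: bcon_subcurve.
move=> Z IZ [ZY Z3].
have [_ Zi] := component_irreducible IZ.
have c Y : closed (val Y) := subcurve_closed (bcon_subcurve Y).
have [Z1|Z2] := Zi _ _ (c Y1) (c Y2) ZY.
  exact: (d13 Z IZ (conj Z1 Z3)).
exact: (d23 Z IZ (conj Z2 Z3)).
Qed.

Lemma translate_excess chi (s : bcon X -> int) tau Y :
  s Y + weight tau (val Y) + (s (bcompl Y) + weight tau (val (bcompl Y)))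
    - (chi + total_weight tau) = s Y + s (bcompl Y) - chi.
Proof.
by rewrite addrACA weight_bcompl opprD addrACA subrr addr0.
Qed.

Lemma translate_subproof (s : vstab) tau :
  is_vstab (characteristic s + total_weight tau)
    (fun Y => s Y + weight tau (val Y)).
Proof.
have [s1 s2] := vstabP s; split => [Y|Y1 Y2 Y3 d12 d13 d23 XY].
  by rewrite translate_excess.
rewrite /degenerate !translate_excess.
have -> : s Y1 + weight tau (val Y1) + (s Y2 + weight tau (val Y2)) +
  (s Y3 + weight tau (val Y3)) - (characteristic s + total_weight tau)
  = s Y1 + s Y2 + s Y3 - characteristic s.
  rewrite (addrACA (s Y1)) (addrACA (s Y1 + s Y2)) weight3 //.
  by rewrite opprD addrACA subrr addr0.
exact: s2.
Qed.

Definition translate (s : vstab) tau : vstab := VStab (translate_subproof s tau).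

Definition translation_orbit (s : vstab) : set vstab := range (translate s).

Lemma vstab_eq (s t : vstab) :
  characteristic s = characteristic t -> s =1 t -> s = t.
Proof.
case: s t => [f chi sP] [g psi tP] /= e /funext fg.
by rewrite e fg in sP *; congr VStab.
Qed.

Lemma translate0 s : translate s (fun=> 0) = s.
Proof.
by apply: vstab_eq => [|Y] /=; rewrite /total_weight /weight fsbig1 ?addr0.
Qed.

Lemma translateD s tau1 tau2 :
  translate s (fun Z => tau1 Z + tau2 Z) = translate (translate s tau1) tau2.
Proof.
by apply: vstab_eq => [|Y] /=; rewrite /total_weight /weight -addrA;
  rewrite fsbig_split //; apply: finite_componentsT.
Qed.

End VStability.

(* Main.v *)
Require Import Defs.
From mathcomp Require Import all_boot all_order all_algebra.
From mathcomp Require Import boolp classical_sets functions cardinality fsbigop.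
From mathcomp Require Import topology_structure connected.
From mathcomp Require Import zify.

(** Translation changes the pair sums s_Y + s_(Y^c) and the characteristic by the
same amount, namely the total weight of tau; so degeneracy is invariant, and the
order is preserved because translation adds the same integers on both sides.

Finiteness of the set of orbits comes from the axioms of a V-stability
condition: they leave only the values 0, 1, 2 for the excesses
s_Y + s_(Y^c) - |s| and s_(Y1) + s_(Y2) + s_(Y3) - |s|.  As X has finitely many
subcurves, the excesses of s form a pattern that takes finitely many values, and
it is enough that two conditions s and t with the same pattern are translates of
each other ([same_pattern_translate]).  For such s and t the difference
f = s - t on BCon(X) is exactly additive, with chi = |s| - |t|:
f(Y) + f(Y^c) = chi, and f(Y1) + f(Y2) + f(Y3) = chi for every decomposition of X
into three biconnected subcurves.  The claim is that such an f is given by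
integer weights on the components, of total chi; these weights are tau.

The claim is a statement about the dual graph, whose vertices are the components
and whose edges join components that meet ([connected_subcurve_of] identifies
the two notions of connectedness).  Extend f to every nonempty connected vertex
set W by F(W) = chi - (sum of f over the connected components of the complement
of W); these components are biconnected because X is connected, so this makes
sense, and F = f on biconnected sets, while F(V) = chi.  The extension is additive: if W1, W2 and
W1 u W2 are connected and W1, W2 are disjoint, then F(W1 u W2) = F(W1) + F(W2)
([connected_extensionU]).  When nothing is left outside W1 u W2 this is
f(W1) + f(W2) = chi.  Otherwise a component C of the rest touches W1 or W2, say
W2, and replacing W2 by W2 u C adds f(C) to both sides ([extension_absorb]).
Splitting connected sets down to single vertices gives
F(W) = sum of F({v}) over v in W, so v |-> F({v}) are the desired weights. *)

Set Implicit Arguments.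
Unset Strict Implicit.
Unset Printing Implicit Defensive.

Import Order.TTheory GRing.Theory Num.Theory.

Local Open Scope ring_scope.

(** * Connectedness in a finite graph *)

Section CutConnectivity.

(* Classical sets redefine set0, setT, subsetP and others; here the names of
   finite sets are meant. *)
Import mathcomp.boot.fintype mathcomp.boot.finset.

Variables (V : finType) (e : rel V).
Hypothesis e_sym : symmetric e.
Implicit Types A B C D S U W : {set V}.

Definition adjacent A B := [exists x in A, exists y in B, e x y].

(** Connectedness by cuts rather than by paths: this is the form in which it
compares directly with topological connectedness. *)
Definition graph_connected S :=
  [forall A : {set V},
    [&& A \subset S, A != set0 & A != S] ==> adjacent A (S :\: A)].

Definition biconnected S :=
  [&& S != set0, S != setT, graph_connected S & graph_connected (~: S)].

(** The connected components of the subgraph on S, obtained as its nonempty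
connected clopen parts. *)
Definition components S : {set {set V}} :=
  [set C : {set V} | [&& C \subset S, C != set0, graph_connected C
                        & ~~ adjacent C (S :\: C)]].

Lemma adjacentP A B :
  reflect (exists x y, [/\ x \in A, y \in B & e x y]) (adjacent A B).
Proof.
apply: (iffP exists_inP) => [[x xA /exists_inP[y yB exy]]|[x [y [xA yB exy]]]].
  by exists x, y.
by exists x => //; apply/exists_inP; exists y.
Qed.

Lemma adjacent_sym A B : adjacent A B = adjacent B A.
Proof.
by apply/adjacentP/adjacentP => -[x [y [xA yB exy]]]; exists y, x; rewrite e_sym.
Qed.

Lemma adjacentS A B A' B' :
  A \subset A' -> B \subset B' -> adjacent A B -> adjacent A' B'.
Proof.
move=> /subsetP sA /subsetP sB /adjacentP[x [y [/sA xA /sB yB exy]]].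
by apply/adjacentP; exists x, y.
Qed.

Lemma adjacentUl A B D : adjacent (A :|: B) D = adjacent A D || adjacent B D.
Proof.
apply/idP/orP => [/adjacentP[x [y [/setUP[xA|xB] yD exy]]]|].
- by left; apply/adjacentP; exists x, y.
- by right; apply/adjacentP; exists x, y.
by case; apply: adjacentS; rewrite // ?subsetUl ?subsetUr.
Qed.

Lemma adjacentUr A B D : adjacent D (A :|: B) = adjacent D A || adjacent D B.
Proof. by rewrite adjacent_sym adjacentUl !(adjacent_sym _ D). Qed.

Lemma connected_clopen S A : graph_connected S -> A \subset S -> A != set0 ->
  ~~ adjacent A (S :\: A) -> A = S.
Proof.
move=> /forallP/(_ A) cS AS A0 nA; apply/eqP; apply: contraNT nA => neq.
by apply: (implyP cS); apply/and3P.
Qed.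

Lemma connected_sub_or_disjoint S A U : graph_connected U -> U \subset S ->
  ~~ adjacent A (S :\: A) -> U \subset A \/ [disjoint U & A].
Proof.
move=> cU US nA; have [UA0|UA0] := eqVneq (U :&: A) set0.
  by right; rewrite -setI_eq0 UA0.
left; apply/setIidPl; apply: (connected_clopen cU) => //; first exact: subsetIl.
apply: contra nA; apply: adjacentS; first exact: subsetIr.
by apply/subsetP => x; rewrite !inE => /andP[]; move/subsetP/(_ x): US;
  case: (x \in U) => //= ->; rewrite ?andbT.
Qed.

Lemma connected1 x : graph_connected [set x].
Proof.
apply/forallP => A; apply/implyP => /and3P[].
by rewrite subset1 => /orP[/eqP->|/eqP->]; rewrite eqxx.
Qed.

Lemma connectedU A B : graph_connected A -> graph_connected B ->
  adjacent A B -> graph_connected (A :|: B).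
Proof.
move=> cA cB AB; apply/forallP => D; apply/implyP => /and3P[DS D0 DneS].
apply: contraT => nD.
have [AD|AD] := connected_sub_or_disjoint cA (subsetUl A B) nD;
have [BD|BD] := connected_sub_or_disjoint cB (subsetUr A B) nD.
- by case/eqP: DneS; apply/eqP; rewrite eqEsubset DS subUset AD BD.
- case/negP: nD; apply: adjacentS AB => //.
  by rewrite subsetD subsetUr.
- rewrite adjacent_sym in AB.
  case/negP: nD; apply: adjacentS AB => //.
  by rewrite subsetD subsetUl.
- case/set0Pn: D0 => x xD; have /setUP[xA|xB] := subsetP DS _ xD.
    by rewrite (disjointFr AD xA) in xD.
  by rewrite (disjointFr BD xB) in xD.
Qed.

(** A clopen part B of S minus C that avoids the connected set U is clopen in S
itself: B has no edge to C because C is a component of S minus U.  So B is empty,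
and every clopen part of S minus C is trivial. *)
Lemma connectedD_component S U C : graph_connected S -> graph_connected U ->
  U != set0 -> U \subset S -> C \in components (S :\: U) ->
  graph_connected (S :\: C).
Proof.
move=> cS cU U0 US; rewrite inE => /and4P[CSU C0 _ nC].
have UC : U \subset S :\: C.
  by rewrite subsetD US; move: CSU; rewrite subsetD disjoint_sym => /andP[].
have no_clopen B : B \subset S :\: C -> ~~ adjacent B ((S :\: C) :\: B) ->
    [disjoint U & B] -> B = set0.
  move=> BSC nB dUB; apply/eqP; apply: contraT => B0.
  have BS : B \subset S by apply: subset_trans BSC (subsetDl _ _).
  have BC : ~~ adjacent B C.
    rewrite adjacent_sym; apply: contra nC; apply: adjacentS => //.
    apply/subsetP => x xB; have := subsetP BSC _ xB; rewrite !inE => /andP[-> ->].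
    by rewrite (disjointFl dUB xB).
  have BE : B = S.
    apply: (connected_clopen cS) => //; apply: contra nB => aB.
    have : adjacent B ((S :\: C :\: B) :|: C).
      apply: adjacentS aB => //; apply/subsetP => x; rewrite !inE.
      by case: (x \in C); rewrite ?orbT ?orbF.
    by rewrite adjacentUr (negbTE BC) orbF.
  case/set0Pn: U0 => x xU; have := disjointFr dUB xU.
  by rewrite BE (subsetP US).
apply/forallP => A; apply/implyP => /and3P[ASC A0 AneS]; apply: contraT => nA.
have [UA|UA] := connected_sub_or_disjoint cU UC nA; last first.
  by rewrite (no_clopen A) ?eqxx in A0.
case/eqP: AneS; apply/eqP; rewrite eqEsubset ASC -setD_eq0; apply/eqP.
apply: no_clopen.
- exact: subsetDl.
- have -> : (S :\: C) :\: ((S :\: C) :\: A) = A.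
    by rewrite setDDr setDv set0U; apply/setIidPr.
  by rewrite adjacent_sym.
- rewrite -setI_eq0 -subset0; apply/subsetP => x; rewrite !inE => /and3P[xU xA _].
  by rewrite (subsetP UA) in xA.
Qed.

(** Otherwise C would be clopen in the connected set S. *)
Lemma component_adjacent S U C : graph_connected S -> U != set0 ->
  U \subset S -> C \in components (S :\: U) -> adjacent C U.
Proof.
move=> cS U0 US; rewrite inE => /and4P[CSU C0 _ nC].
have [CS /disjointFl dCU] : C \subset S /\ [disjoint C & U].
  by move: CSU; rewrite subsetD => /andP[].
have : adjacent C (S :\: C).
  apply: contraT => nCS; have CE := connected_clopen cS CS C0 nCS.
  case/set0Pn: U0 => x xU; have := dCU _ xU.
  by rewrite CE (subsetP US).
have -> : S :\: C = U :|: ((S :\: U) :\: C).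
  apply/setP => x; rewrite !inE; case xU: (x \in U) => //=.
  by rewrite (dCU _ xU) (subsetP US).
by rewrite adjacentUr (negbTE nC) orbF.
Qed.

(** The component of x is a minimal clopen part of S containing x: a clopen part
of it is clopen in S, and so is its relative complement. *)
Lemma mem_component S x : x \in S -> exists2 C, C \in components S & x \in C.
Proof.
move=> xS.
pose P A := [&& x \in A, A \subset S & ~~ adjacent A (S :\: A)].
have PS : P S.
  rewrite /P xS subxx setDv; apply/negP => /adjacentP[u [v [_]]].
  by rewrite inE.
have [C /minsetP[/and3P[xC CS nC] Cmin] _] := minset_exists PS.
exists C => //; rewrite inE CS nC andbT /=; apply/andP; split.
  by apply/set0Pn; exists x.
apply/forallP => A; apply/implyP => /and3P[AC A0 AneC]; apply: contraT => nA.
have clopen B : B \subset C -> ~~ adjacent B (C :\: B) -> x \in B -> B = C.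
  move=> BC nB xB; apply: Cmin => //; rewrite /P xB (subset_trans BC CS) /=.
  have -> : S :\: B = (C :\: B) :|: (S :\: C).
    apply/setP => y; rewrite !inE; have := subsetP BC y; have := subsetP CS y.
    by case: (y \in B); case: (y \in C); case: (y \in S) => //= h1 h2;
      rewrite ?h1 ?h2 //; case: (h2 isT).
  rewrite adjacentUr (negbTE nB) /=; apply: contra nC.
  by apply: adjacentS.
have [xA|xA] := boolP (x \in A); first by rewrite (clopen A) ?eqxx in AneC.
have AC2 : C :\: (C :\: A) = A by rewrite setDDr setDv set0U; apply/setIidPr.
have CA : C :\: A = C.
  apply: clopen; first exact: subsetDl.
    by rewrite AC2 adjacent_sym.
  by rewrite inE xA.
by rewrite CA setDv in AC2; rewrite -AC2 eqxx in A0.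
Qed.

Lemma component_containing S U : graph_connected U -> U != set0 -> U \subset S ->
  exists2 C, C \in components S & U \subset C.
Proof.
move=> cU /set0Pn[x xU] US; have [C CS xC] := mem_component (subsetP US x xU).
exists C => //; move: (CS); rewrite inE => /and4P[_ _ _ nC].
have [//|dUC] := connected_sub_or_disjoint cU US nC.
by rewrite (disjointFr dUC xU) in xC.
Qed.

Lemma components_disjoint S C D : C \in components S -> D \in components S ->
  C != D -> [disjoint C & D].
Proof.
rewrite !inE => /and4P[CS C0 cC nC] /and4P[DS D0 cD nD] CD.
have [sCD|//] := connected_sub_or_disjoint cC CS nD.
have [sDC|] := connected_sub_or_disjoint cD DS nC; last by rewrite disjoint_sym.
by case/eqP: CD; apply/eqP; rewrite eqEsubset sCD.
Qed.

Lemma componentsD S C : C \in components S ->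
  components (S :\: C) = components S :\ C.
Proof.
move=> CS; apply/setP => D; apply/idP/idP => [|/setD1P[DC DS]].
  move: (CS); rewrite !inE => /and4P[CsubS C0 cC nC] /and4P[DSC D0 cD nD].
  have /andP[DS dDC] : (D \subset S) && [disjoint D & C] by rewrite -subsetD.
  apply/and5P; split => //.
    apply/eqP => DC; case/set0Pn: D0 => x xD; have := disjointFr dDC xD.
    by rewrite -DC xD.
  have -> : S :\: D = C :|: ((S :\: C) :\: D).
    apply/setP => x; rewrite !inE; case xC: (x \in C) => //=.
    by rewrite (disjointFl dDC xC) (subsetP CsubS).
  rewrite adjacentUr (negbTE nD) orbF adjacent_sym; apply: contra nC.
  by apply: adjacentS => //; rewrite subsetD DS.
have dDC := components_disjoint DS CS DC.
move: DS; rewrite !inE => /and4P[DS D0 cD nD]; apply/and4P; split => //.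
  by rewrite subsetD DS.
by apply: contra nD; apply: adjacentS => //; apply/setSD/subsetDl.
Qed.

Lemma components_connected S : graph_connected S -> S != set0 ->
  components S = [set S].
Proof.
move=> cS S0; apply/setP => C; rewrite !inE; apply/idP/eqP.
  by move=> /and4P[CS C0 _ nC]; apply: connected_clopen.
move=> ->; rewrite subxx S0 cS setDv; apply/negP => /adjacentP[u [v [_]]].
by rewrite inE.
Qed.

Lemma components0 : components set0 = set0.
Proof.
apply/setP => C; rewrite !inE subset0.
by case: eqP.
Qed.

Lemma biconnectedC A : biconnected (~: A) = biconnected A.
Proof.
rewrite /biconnected setCK [graph_connected (~: A) && _]andbC.
rewrite -(inj_eq (@setC_inj _)) setCK setC0 -[~: A == setT](inj_eq (@setC_inj _)).
by rewrite setCK setCT andbCA.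
Qed.

(** * Additive functions on biconnected sets are weights *)

Section ComplementAdditive.
Variables (M : zmodType) (chi : M) (f : {set V} -> M).
Hypothesis V_connected : graph_connected setT.
Hypothesis f_compl : forall A, biconnected A -> f A + f (~: A) = chi.
Hypothesis f_split : forall A B, biconnected A -> biconnected B ->
  biconnected (A :|: B) -> [disjoint A & B] -> f A + f B + f (~: (A :|: B)) = chi.

Definition components_sum S := \sum_(C in components S) f C.

(** For biconnected W this is chi - f (~: W) = f W; the formula also makes sense
when the complement of W falls into several pieces. *)
Definition connected_extension W := chi - components_sum (~: W).

Lemma component_biconnected W C : graph_connected W -> W != set0 ->
  C \in components (~: W) -> biconnected C.
Proof.
move=> cW W0; rewrite -setTD => CW; apply/and4P; split.
- by move: CW; rewrite inE => /and4P[].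
- move: CW; rewrite inE => /and4P[CW _ _ _].
  apply: contraNneq W0 => CT; move: CW; rewrite CT subTset setTD => /eqP CW.
  by rewrite -[W]setCK CW setCT.
- by move: CW; rewrite inE => /and4P[].
- by rewrite -setTD; apply: (connectedD_component V_connected cW) => //; apply: subsetT.
Qed.

Lemma components_sumD1 S C : C \in components S ->
  components_sum S = f C + components_sum (S :\: C).
Proof.
by move=> CS; rewrite /components_sum (big_setD1 C) //= componentsD.
Qed.

(** If C does not touch W1, then C is also a component of the complement of W2,
and it only has to be removed from the sum.  Otherwise let B be the component of
the complement of W2 u C that contains W1: in the complement of W2 the sets B and
C merge into the component B u C, all other components being the same, and
f(B u C) = f(B) + f(C) by additivity on the triple B, C, (B u C)^c.  The role of
W1 is to make B unique: any other component of the complement of W2 u C lies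
off W1 and does not touch C. *)
Lemma extension_absorb W1 W2 C : graph_connected W1 -> graph_connected W2 ->
  W1 != set0 -> W2 != set0 -> [disjoint W1 & W2] ->
  graph_connected (W1 :|: W2) -> C \in components (~: (W1 :|: W2)) ->
  adjacent C W2 ->
  connected_extension (W2 :|: C) = connected_extension W2 + f C.
Proof.
move=> c1 c2 n1 n2 d12 c12 C12 CW2.
have n12 : W1 :|: W2 != set0 by rewrite setU_eq0 negb_and n1.
have bC := component_biconnected c12 n12 C12.
move: (C12); rewrite inE => /and4P[CS C0 cC nC].
have c2C : graph_connected (W2 :|: C).
  by apply: connectedU => //; rewrite adjacent_sym.
have n2C : W2 :|: C != set0 by rewrite setU_eq0 negb_and n2.
have CE : ~: (W2 :|: C) = ~: W2 :\: C by rewrite setCU setDE.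
have CW x : x \in C -> (x \notin W1) && (x \notin W2).
  by move/(subsetP CS); rewrite !inE negb_or.
have W12 x : x \in W1 -> x \notin W2 by move=> /(disjointFr d12) ->.
rewrite /connected_extension.
suff -> : components_sum (~: W2) = f C + components_sum (~: (W2 :|: C)).
  by rewrite opprD addrA addrAC subrK.
have [C1|C1] := boolP (adjacent C W1); last first.
  rewrite CE; apply: components_sumD1; rewrite inE C0 cC /=; apply/andP; split.
    by apply: subset_trans CS _; rewrite setCS subsetUr.
  have : ~~ adjacent C (W1 :|: (~: (W1 :|: W2) :\: C)).
    by rewrite adjacentUr negb_or C1.
  apply: contra; apply: adjacentS => //; apply/subsetP => x; rewrite !inE.
  by case: (x \in W1) => //=; rewrite orbF.
have W1S : W1 \subset ~: (W2 :|: C).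
  apply/subsetP => x x1; rewrite !inE negb_or W12 //=.
  by apply: contraL x1 => /CW/andP[].
have [B BS W1B] := component_containing c1 n1 W1S.
have bB := component_biconnected c2C n2C BS.
move: (BS); rewrite inE => /and4P[BsubS B0 cB nB].
have BCS x : x \in B -> (x \notin W2) && (x \notin C).
  by move/(subsetP BsubS); rewrite !inE negb_or.
have BCcomp : B :|: C \in components (~: W2).
  rewrite inE; apply/and4P; split.
  - apply/subsetP => x /setUP[/BCS/andP[]|/CW/andP[]]; rewrite inE //.
  - by rewrite setU_eq0 negb_and B0.
  - apply: connectedU => //; rewrite adjacent_sym.
    exact: adjacentS C1.
  - rewrite adjacentUl negb_or; apply/andP; split.
      by apply: contra nB; apply: adjacentS; rewrite // CE setDDl setUC.
    apply: contra nC; apply: adjacentS => //; apply/subsetP => x.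
    rewrite !inE !negb_or => /andP[/andP[xB ->] ->] /=.
    by rewrite andbT; apply: contra xB => /(subsetP W1B).
have bBC := component_biconnected c2 n2 BCcomp.
have dBC : [disjoint B & C].
  by rewrite -setI_eq0 -subset0; apply/subsetP => x /setIP[/BCS/andP[_ /negbTE->]].
rewrite (components_sumD1 BCcomp) (components_sumD1 BS).
have -> : ~: W2 :\: (B :|: C) = ~: (W2 :|: C) :\: B.
  by rewrite CE setDDl setUC.
suff -> : f (B :|: C) = f B + f C by rewrite addrCA -!addrA addrCA.
apply: (addIr (f (~: (B :|: C)))).
by rewrite f_compl // f_split.
Qed.

(** Induction on the number of vertices outside W1 u W2, absorbing into W1 or W2
one component of the complement at a time. *)
Lemma connected_extensionU W1 W2 : graph_connected W1 -> graph_connected W2 ->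
  W1 != set0 -> W2 != set0 -> [disjoint W1 & W2] -> graph_connected (W1 :|: W2) ->
  connected_extension (W1 :|: W2) = connected_extension W1 + connected_extension W2.
Proof.
have [n] := ubnP #|~: (W1 :|: W2)|.
elim: n W1 W2 => // n IH W1 W2; rewrite ltnS => leS c1 c2 n1 n2 d12 c12.
have [S0|/set0Pn[x xS]] := eqVneq (~: (W1 :|: W2)) set0.
  have W12 : W1 :|: W2 = setT by rewrite -[LHS]setCK S0 setC0.
  have W2E : ~: W1 = W2.
    apply/setP => y; have := in_setT y; rewrite -W12 !inE.
    by case y1: (y \in W1) => //= _; rewrite (disjointFr d12 y1).
  have W1E : ~: W2 = W1 by rewrite -W2E setCK.
  rewrite /connected_extension S0 W2E W1E /components_sum components0 big_set0.
  rewrite !components_connected // !big_set1 subr0.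
  have W1T : W1 != setT by apply: contraNneq n2 => W1T; rewrite -W2E W1T setCT.
  have <- : f W1 + f W2 = chi.
    rewrite -[X in f X + f _ = _]W1E -W2E setCK.
    by rewrite f_compl // /biconnected n1 W1T c1 W2E.
  by rewrite addrK [X in _ = _ + X]addrAC subrr add0r addrC.
have [C CS xC] := mem_component xS.
have n12 : W1 :|: W2 != set0 by rewrite setU_eq0 negb_and n1.
have : adjacent C (W1 :|: W2).
  by apply: (component_adjacent V_connected) => //; rewrite ?subsetT ?setTD.
wlog CW2 : W1 W2 leS c1 c2 n1 n2 d12 c12 xS CS n12 / adjacent C W2.
  move=> H; rewrite adjacentUr => /orP[CW|CW]; last first.
    by apply: H => //; rewrite adjacentUr CW orbT.
  by rewrite setUC addrC; apply: H;
    rewrite 1?(setUC W2) 1?disjoint_sym ?adjacentUr ?CW ?orbT.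
move=> _.
move: (CS); rewrite inE => /and4P[CsubS C0 cC nC].
have c2C : graph_connected (W2 :|: C).
  by apply: connectedU => //; rewrite adjacent_sym.
have absorbE U : ~: (U :|: C) = ~: U :\: C by rewrite setCU setDE.
have E12 : connected_extension (W1 :|: W2 :|: C)
    = connected_extension (W1 :|: W2) + f C.
  rewrite /connected_extension (components_sumD1 CS) absorbE.
  by rewrite opprD addrA addrAC subrK.
apply: (addIr (f C)); rewrite -E12 -addrA.
rewrite -(extension_absorb c1 c2) // -setUA; apply: IH => //.
- rewrite setUA absorbE; apply: leq_trans leS.
  apply: proper_card; apply/properP; split; first exact: subsetDl.
  by exists x; rewrite // inE xC.
- by rewrite setU_eq0 negb_and n2.
- rewrite -setI_eq0 setIUr setU_eq0 setI_eq0 d12 setI_eq0 disjoint_sym.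
  move: CsubS; rewrite setCU subsetI => /andP[].
  by rewrite subsetC -disjoints_subset disjoint_sym.
- rewrite setUA; apply: connectedU => //.
  by rewrite adjacentUl orbC adjacent_sym CW2.
Qed.

(** A connected set with more than one vertex splits into two smaller connected
sets: a component C of what remains after deleting a vertex, and the rest, which
is connected by [connectedD_component]. *)
Lemma connected_extension_sum W : graph_connected W -> W != set0 ->
  connected_extension W = \sum_(v in W) connected_extension [set v].
Proof.
have [n] := ubnP #|W|; elim: n W => // n IH W; rewrite ltnS => leW cW W0.
have /set0Pn[x xW] := W0.
have xsub : [set x] \subset W by rewrite sub1set.
have x0 : [set x] != set0 by apply/set0Pn; exists x; rewrite inE.
have [->|] := eqVneq W [set x]; first by rewrite big_set1.
rewrite eqEsubset xsub andbT -setD_eq0 => /set0Pn[y yW].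
have [C CW yC] := mem_component yW.
have cWC := connectedD_component cW (connected1 x) x0 xsub CW.
move: CW; rewrite inE => /and4P[]; rewrite subsetD => /andP[CW dxC] C0 cC _.
have xC : x \in W :\: C.
  rewrite inE xW andbT; apply/negP => xC.
  by have := disjointFr dxC xC; rewrite inE eqxx.
have WC0 : W :\: C != set0 by apply/set0Pn; exists x.
have WE : W = C :|: (W :\: C) by rewrite -{1}(setID W C) (setIidPr CW).
have dC : [disjoint C & W :\: C].
  by rewrite disjoint_sym disjoints_subset setDE subsetIr.
rewrite (big_setID C) /= (setIidPr CW) {1}WE connected_extensionU -?WE //.
congr (_ + _); apply: IH => //; apply: leq_trans leW; apply: proper_card.
  by apply/properP; split=> //; exists x => //; move: xC; rewrite inE => /andP[].
apply/properP; split; first exact: subsetDl.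
by exists y; rewrite ?inE ?yC //; apply: (subsetP CW).
Qed.

Lemma biconnected_additive_weight : [set: V] != set0 ->
  exists w : V -> M, (forall A, biconnected A -> f A = \sum_(v in A) w v)
    /\ \sum_v w v = chi.
Proof.
move=> VT0; exists (fun v => connected_extension [set v]); split=> [A bA|].
  have /and4P[A0 AT cA cAC] := bA.
  rewrite -connected_extension_sum // /connected_extension /components_sum.
  rewrite components_connected // ?big_set1 -?(f_compl bA) ?addrK //.
  by rewrite -(inj_eq (@setC_inj _)) setCK setC0.
transitivity (connected_extension [set: V]).
  by rewrite connected_extension_sum //; apply: eq_bigl => v; rewrite inE.
rewrite /connected_extension /components_sum setCT components0.
by rewrite big_set0 subr0.
Qed.

End ComplementAdditive.
End CutConnectivity.

Local Open Scope classical_set_scope.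

(** * The dual graph of a curve *)

Section DualGraph.
Variables (k : closedFieldType) (X : curve k).
Local Notation T := (projective_space k (ambient_dim X)).
Local Notation I := (irreducible_components X).
Variables (V : finType) (g : V -> I) (g' : I -> V).
Hypotheses (gK : cancel g g') (g'K : cancel g' g).
Implicit Types (A B : {set V}) (v : V).

Definition meet_rel : rel V := fun u v => `[< val (g u) `&` val (g v) !=set0 >].

Definition subcurve_of A : set T := \bigcup_(v in [set` A]) val (g v).

Lemma meet_rel_sym : symmetric meet_rel.
Proof. by move=> u v; rewrite /meet_rel setIC. Qed.

Lemma subcurve_ofE A :
  subcurve_of A = \bigcup_(Z in [set val (g v) | v in [set` A]]) Z.
Proof. by rewrite bigcup_image. Qed.

Lemma image_components A : [set val (g v) | v in [set` A]] `<=` I.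
Proof. by move=> _ [v _ <-]; apply: set_valP. Qed.

Lemma subcurve_of_subcurve A : subcurve X (subcurve_of A).
Proof. by rewrite subcurve_ofE; eexists; first exact: image_components. Qed.

Lemma subcurve_of_closed A : closed (subcurve_of A).
Proof. by apply: subcurve_closed; apply: subcurve_of_subcurve. Qed.

Lemma component_sub_subcurve_of A v :
  val (g v) `<=` subcurve_of A <-> v \in A.
Proof.
split=> [|vA]; last exact: (@bigcup_sup _ _ v [set` A] (fun v => val (g v))).
rewrite subcurve_ofE => /(component_sub_bigcup (@image_components A) (set_valP _)).
by move=> [u uA /val_inj/(can_inj gK) <-].
Qed.

Lemma subcurve_of_inj : injective subcurve_of.
Proof.
move=> A B AB; apply/setP => v.
by apply/idP/idP => /component_sub_subcurve_of vA;
  apply/component_sub_subcurve_of; move: vA; rewrite AB.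
Qed.

Lemma subcurveP (Y : set T) : subcurve X Y -> exists A, Y = subcurve_of A.
Proof.
move=> sY; exists [set v | `[< val (g v) `<=` Y >]]%SET.
rewrite {1}(subcurveE sY); apply/seteqP; split => x.
  move=> [Z [IZ /= ZY] Zx]; pose Z' : I := exist _ Z (mem_set IZ).
  by exists (g' Z'); rewrite /= ?inE g'K //; apply/asboolP.
move=> [v /=]; rewrite inE => /asboolP vY vx; exists (val (g v)) => //.
by split=> //; apply: set_valP.
Qed.

Lemma subcurve_ofT : subcurve_of [set: V]%SET = X.
Proof.
rewrite -components_cover; apply/seteqP; split=> x.
  by move=> [v _ vx]; exists (val (g v)) => //; apply: set_valP.
move=> [Z IZ Zx]; pose Z' : I := exist _ Z (mem_set IZ).
by exists (g' Z'); rewrite /= ?inE ?g'K.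
Qed.

Lemma subcurve_of0 : subcurve_of finset.set0 = set0.
Proof. by apply/seteqP; split=> x // [v /=]; rewrite inE. Qed.

Lemma subcurve_ofC A : subcurve_of (~: A)%SET = compl X (subcurve_of A).
Proof.
rewrite complE; last exact: subcurve_of_subcurve.
apply/seteqP; split=> x.
  move=> [v /=]; rewrite inE => vA vx; exists (val (g v)) => //; split => /=.
    exact: set_valP.
  by move=> /component_sub_subcurve_of; apply/negP.
move=> [Z [IZ /= ZA] Zx]; pose Z' : I := exist _ Z (mem_set IZ).
exists (g' Z'); rewrite /= ?g'K // inE; apply/negP => /component_sub_subcurve_of.
by rewrite g'K.
Qed.

Lemma subcurve_ofU A B :
  subcurve_of (A :|: B)%SET = subcurve_of A `|` subcurve_of B.
Proof.
rewrite -bigcup_setU; congr bigcup; apply/seteqP; split=> v /=.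
  by move=> /finset.setUP.
by move=> AB; apply/finset.setUP.
Qed.

Lemma no_common_component_disjoint A B : [disjoint A & B]%B ->
  no_common_component X (subcurve_of A) (subcurve_of B).
Proof.
move=> AB Z IZ; pose Z' : I := exist _ Z (mem_set IZ).
have -> : Z = val (g (g' Z')) by rewrite g'K.
move=> [/component_sub_subcurve_of ZA /component_sub_subcurve_of].
by rewrite (disjointFr AB ZA).
Qed.

Lemma subcurve_of_meet A B :
  subcurve_of A `&` subcurve_of B !=set0 <-> adjacent meet_rel A B.
Proof.
split=> [[x [[u uA ux] [v vB vx]]]|/adjacentP[u [v [uA vB /asboolP[x [ux vx]]]]]].
  by apply/adjacentP; exists u, v; split=> //; apply/asboolP; exists x.
by exists x; split; [exists u|exists v].
Qed.

(** From topology to graphs: disjoint finite unions of components are closed and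
hence relatively open in their union.  Conversely, a component is irreducible, so
it lies inside a relatively clopen subset Y or off Y; thus Y is a union of
components without edges to the remaining ones. *)
Lemma connected_subcurve_of A :
  connected (subcurve_of A) <-> graph_connected meet_rel A.
Proof.
split=> [cA|gA].
  apply/forallP => B; apply/implyP => /and3P[BA B0 BneA].
  apply: contraT => /negP nB; have sBA : subcurve_of B `<=` subcurve_of A.
    by apply: bigcup_subset => v /=; apply: (fintype.subsetP BA).
  suff /subcurve_of_inj BE : subcurve_of B = subcurve_of A by rewrite BE eqxx in BneA.
  apply: cA.
  - have [v vB] := finset.set0Pn _ B0.
    have [[x vx] _] := component_irreducible (set_valP (g v)).
    by exists x, v.
  - exists (~` subcurve_of (A :\: B)%SET).
      by rewrite openC; apply: subcurve_of_closed.
    apply/seteqP; split=> x.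
      move=> Bx; split; first exact: sBA.
      by move=> Dx; apply: nB; apply/subcurve_of_meet; exists x.
    move=> [[v vA vx] nD]; have [vB|vB] := boolP (v \in B); first by exists v.
    by case: nD; exists v; rewrite //= inE vB.
  - exists (subcurve_of B); first exact: subcurve_of_closed.
    by apply/esym/setIidPr.
move=> Y [x Yx] [O oO YO] [C cC YC].
pose B : {set V} := [set v in A | `[< val (g v) `<=` Y >]]%SET.
have dich v : v \in A -> val (g v) `<=` Y \/ val (g v) `<=` ~` O.
  move=> vA; have [_ irr] := component_irreducible (set_valP (g v)).
  have vsub : val (g v) `<=` subcurve_of A by apply/component_sub_subcurve_of.
  have [| |y vy|vC|vO] := irr C (~` O); last by right.
  - exact: cC.
  - by rewrite closedC.
  - have [Oy|nOy] := pselect (O y); last by right.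
    by left; have : Y y by [rewrite YO; split=> //; apply: vsub]; rewrite YC => -[].
  - by left; rewrite YC => y vy; split; [apply: vsub|apply: vC].
have BY : subcurve_of B = Y.
  apply/seteqP; split=> y.
    by move=> [v /=]; rewrite inE => /andP[_ /asboolP vY] vy; apply: vY.
  move=> Yy; have : subcurve_of A y by move: Yy; rewrite YO => -[].
  move=> [v vA vy]; exists v => //=; rewrite inE; apply/andP; split=> //.
  apply/asboolP; have [//|vO] := dich v vA.
  by case: (vO y vy); move: Yy; rewrite YO => -[].
rewrite -BY; congr subcurve_of; apply: (connected_clopen gA).
- by apply/fintype.subsetP => v; rewrite inE => /andP[].
- by apply/finset.set0Pn; move: Yx; rewrite -BY => -[v vB _]; exists v.
- apply/negP => /subcurve_of_meet[y [+ [v /=]]]; rewrite BY !inE => Yy.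
  move=> /andP[vnB vA] vy; rewrite vA /= in vnB.
  have [vY|vO] := dich v vA; first by move/asboolP: vnB.
  by case: (vO y vy); move: Yy; rewrite YO => -[].
Qed.

Lemma bcon_subcurve_of A : bcon X (subcurve_of A) <-> biconnected meet_rel A.
Proof.
rewrite /bcon /= -subcurve_ofC; split.
  move=> [_ A0 AX /connected_subcurve_of cA /connected_subcurve_of cAC].
  apply/and4P; split=> //.
    by apply/eqP => AE; apply: A0; rewrite AE subcurve_of0.
  by apply/eqP => AE; apply: AX; rewrite AE subcurve_ofT.
move=> /and4P[/eqP A0 /eqP AT /connected_subcurve_of cA /connected_subcurve_of cAC].
split=> //; first exact: subcurve_of_subcurve.
  by rewrite -subcurve_of0 => /subcurve_of_inj.
by rewrite -subcurve_ofT => /subcurve_of_inj.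
Qed.

Lemma weight_subcurve_of (tau : I -> int) A :
  weight tau (subcurve_of A) = \sum_(v in A) tau (g v).
Proof.
rewrite /weight.
have -> : [set Z : I | val Z `<=` subcurve_of A] = [set` [seq g v | v <- enum A]].
  apply/seteqP; split=> Z /=; rewrite -{1}(g'K Z).
    move/component_sub_subcurve_of => ZA; apply/mapP; exists (g' Z); rewrite ?g'K //.
    by rewrite mem_enum.
  by rewrite g'K => /mapP[v]; rewrite mem_enum => vA ->; apply/component_sub_subcurve_of.
rewrite -fsbig_seq; last by rewrite map_inj_uniq ?enum_uniq //; apply: can_inj gK.
by rewrite big_map big_enum.
Qed.

Lemma total_weight_of (tau : I -> int) : total_weight tau = \sum_v tau (g v).
Proof.
have := weight_subcurve_of tau [set: V]%SET; rewrite subcurve_ofT weightT => ->.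
by apply: eq_bigl => v; rewrite inE.
Qed.

(** * The excess pattern of a V-stability condition *)

(** Extension by 0 to all vertex sets, which makes it possible to record the
excesses in a finite function on vertex sets. *)
Definition value_on (s : bcon X -> int) A : int :=
  if pselect (bcon X (subcurve_of A)) is left h then s (SigSub (mem_set h)) else 0.

Lemma value_onE (s : bcon X -> int) (Y : bcon X) A :
  val Y = subcurve_of A -> value_on s A = s Y.
Proof.
move=> YA; rewrite /value_on; case: pselect => [h|[]].
  by congr s; apply: val_inj.
by rewrite -YA; apply: set_valP.
Qed.

Lemma bcon_of A : biconnected meet_rel A ->
  exists Y : bcon X, val Y = subcurve_of A.
Proof. by move/bcon_subcurve_of => h; exists (SigSub (mem_set h)). Qed.

Definition pair_excess (s : vstab X) A : int :=
  value_on s A + value_on s (~: A)%SET - characteristic s.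

(** The third member of the decomposition is the complement of the union of the
first two. *)
Definition triple_excess (s : vstab X) A B : int :=
  value_on s A + value_on s B + value_on s (~: (A :|: B))%SET - characteristic s.

(** All relevant excesses lie in {0, 1, 2}, hence the codes in 'I_3; excesses
outside biconnected sets receive meaningless codes. *)
Definition excess_pattern (s : vstab X) :
    {ffun {set V} -> 'I_3} * {ffun {set V} * {set V} -> 'I_3} :=
  ([ffun A => inord `|pair_excess s A|%N],
   [ffun AB => inord `|triple_excess s AB.1 AB.2|%N]).

Lemma pair_excess_small (s : vstab X) A : biconnected meet_rel A ->
  pair_excess s A \in [:: 0; 1; 2].
Proof.
move=> /bcon_of[Y YA]; rewrite /pair_excess (value_onE s YA).
rewrite (@value_onE s (bcompl Y)); last by rewrite /= YA subcurve_ofC.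
by have [/(_ Y) + _] := vstabP s; rewrite !inE => /orP[]->; rewrite ?orbT.
Qed.

Lemma triple_excess_small (s : vstab X) A B :
  biconnected meet_rel A -> biconnected meet_rel B ->
  biconnected meet_rel (A :|: B)%SET -> [disjoint A & B]%B ->
  triple_excess s A B \in [:: 0; 1; 2].
Proof.
move=> /bcon_of[Y1 Y1A] /bcon_of[Y2 Y2B] bAB dAB.
have /bcon_of[Y3 Y3C] : biconnected meet_rel (~: (A :|: B))%SET.
  by rewrite biconnectedC.
rewrite /triple_excess (value_onE s Y1A) (value_onE s Y2B) (value_onE s Y3C).
have [_ /(_ Y1 Y2 Y3)] := vstabP s.
rewrite Y1A Y2B Y3C => -[].
- exact: no_common_component_disjoint.
- apply: no_common_component_disjoint.
  by rewrite finset.disjoints_subset finset.setCK finset.subsetUl.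
- apply: no_common_component_disjoint.
  by rewrite finset.disjoints_subset finset.setCK finset.subsetUr.
- by rewrite -!subcurve_ofU finset.setUCr subcurve_ofT.
(* The implications between the d_i exclude exactly two degenerate members. *)
move=> [D1 D2 D3] [E0 E1 E3]; move: D1 D2 D3 E0 E1 E3.
case: (degenerate _ _ Y1); case: (degenerate _ _ Y2); case: (degenerate _ _ Y3);
  move=> D1 D2 D3 E0 E1 E3; try by [move: (D1 isT isT)|move: (D2 isT isT)
    |move: (D3 isT isT)|rewrite E1|rewrite E3].
by have := E0 erefl; rewrite !inE => /orP[]->; rewrite ?orbT.
Qed.

Lemma excess_code_inj (x y : int) : x \in [:: 0; 1; 2] -> y \in [:: 0; 1; 2] ->
  inord `|x|%N = inord `|y|%N :> 'I_3 -> x = y.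
Proof.
by rewrite !inE => /or3P[]/eqP-> /or3P[]/eqP-> /(congr1 val) /=; rewrite !inordK.
Qed.

Hypothesis X_connected : connected X.

(** Equal excesses cancel in s - t, which becomes exactly additive; its weights
are tau. *)
Lemma same_pattern_translate (s t : vstab X) :
  excess_pattern s = excess_pattern t -> exists tau, s = translate t tau.
Proof.
case=> /ffunP pairE /ffunP tripleE.
pose f A := value_on s A - value_on t A.
pose chi := characteristic s - characteristic t.
have gT : graph_connected meet_rel [set: V]%SET.
  by apply/connected_subcurve_of; rewrite subcurve_ofT.
have fC A : biconnected meet_rel A -> f A + f (~: A)%SET = chi.
  move=> bA; have := pairE A; rewrite !ffunE.
  move=> /(excess_code_inj (pair_excess_small s bA) (pair_excess_small t bA)).
  rewrite /pair_excess /f /chi; lia.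
have f3 A B : biconnected meet_rel A -> biconnected meet_rel B ->
    biconnected meet_rel (A :|: B)%SET -> [disjoint A & B]%B ->
    f A + f B + f (~: (A :|: B))%SET = chi.
  move=> bA bB bAB dAB; have := tripleE (A, B); rewrite !ffunE /=.
  move=> /(excess_code_inj (triple_excess_small s bA bB bAB dAB)
                           (triple_excess_small t bA bB bAB dAB)).
  rewrite /triple_excess /f /chi; lia.
have VT0 : [set: V]%SET != finset.set0.
  apply/eqP => VT0; have [x] := @curve_neq0 _ X.
  by rewrite -subcurve_ofT VT0 subcurve_of0.
have [w [wA wT]] := biconnected_additive_weight meet_rel_sym gT fC f3 VT0.
exists (w \o g'); apply: vstab_eq => [|Y] /=.
  rewrite total_weight_of; under eq_bigr do rewrite /= gK.
  by rewrite wT addrC subrK.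
have [A YA] := subcurveP (bcon_subcurve Y).
rewrite YA weight_subcurve_of.
under eq_bigr do rewrite /= gK.
rewrite -wA; last by apply/bcon_subcurve_of; rewrite -YA; apply: set_valP.
by rewrite /f (value_onE s YA) (value_onE t YA) addrC subrK.
Qed.

End DualGraph.

(** * Finiteness of the set of orbits *)

Lemma finite_type_bijection (T : choiceType) : finite_set [set: T] ->
  exists (V : finType) (g : V -> T) (g' : T -> V), cancel g g' /\ cancel g' g.
Proof.
move=> /finite_seqP[s sT].
have sP (x : T) : x \in s by have : [set: T] x by []; rewrite sT.
by exists (seq_sub s), (@ssval _ _), (fun x => SeqSub (sP x)); split=> // x; apply: val_inj.
Qed.

Lemma finite_set_factor (A B : Type) (P : finType) (p : A -> P) (h : A -> B) :
  (forall s t, p s = p t -> h s = h t) -> finite_set [set h s | s in [set: A]].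
Proof.
move=> ph; have [[s0 _]|A0] := pselect ([set: A] !=set0); last first.
  rewrite (_ : image _ _ = set0) //; apply/seteqP; split=> // y [s _ _].
  by apply: A0; exists s.
pose r q : A := if pselect (exists s, p s = q) is left e then sval (cid e) else s0.
have -> : [set h s | s in [set: A]] = [set h (r q) | q in [set: P]].
  apply/seteqP; split=> _ [x _ <-]; last by exists (r x).
  exists (p x) => //; apply: ph; rewrite /r; case: pselect => [e|[]]; last by exists x.
  exact: svalP (cid e).
exact/finite_image/finite_finset.
Qed.

Lemma translation_orbit_translate (k : closedFieldType) (X : curve k)
    (s : vstab X) (tau : irreducible_components X -> int) :
  translation_orbit (translate s tau) = translation_orbit s.
Proof.
apply/seteqP; split=> _ [tau' _ <-]; first by eexists; last exact: translateD.
exists (fun Z => - tau Z + tau' Z) => //; rewrite -translateD; congr translate.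
by apply/funext => Z; rewrite addNKr.
Qed.

Theorem proposition4p16 (k : closedFieldType) (X : curve k)
    (X_connected : connected X) :
  [/\ forall (s : vstab X) (tau : irreducible_components X -> int),
        degeneracy (translate s tau) = degeneracy s,
      forall (s t : vstab X) (tau : irreducible_components X -> int),
        vstab_ge s t -> vstab_ge (translate s tau) (translate t tau)
    & finite_set [set translation_orbit s | s in [set: vstab X]]].
Proof.
split=> [s tau|s t tau [st_char st]|].
- by apply/seteqP; split=> Y; rewrite /degeneracy /= /degenerate /= translate_excess.
- by split=> [|Y] /=; rewrite ?st_char // lerD2r.
have [V [g [g' [gK g'K]]]] :=
  finite_type_bijection (finite_componentsT [set: irreducible_components X]).
apply: (finite_set_factor (p := excess_pattern g)) => s t st.
have [tau ->] := same_pattern_translate gK g'K X_connected st.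
exact: translation_orbit_translate.
Qed.
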